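(* There exists a directed set $\mathcal A$, which is not a cardinal number, with $\operatorname{card}(\mathcal A)=\operatorname{add}(\mathcal N)$, such that $\mathcal{AN}_{\mathcal A}$ is strongly $\mathfrak c$-algebrable in $\left(\mathbb R^{\mathbb R}\right)^{\mathcal A}$.
   Context: A directed set is a nonempty set $\mathcal A$ with a reflexive transitive relation $\le$ in which any two elements have an upper bound; $x_A\to x$ if for each neighbourhood $U$ of $x$ there is $A_0$ with $x_A\in U$ for $A\ge A_0$. $\left(\mathbb R^{\mathbb R}\right)^{\mathcal A}$ is the commutative real algebra of nets of functions $\mathbb R\to\mathbb R$ with indexwise addition, multiplication and scalar multiplication. $\mathcal N$ denotes the Lebesgue null sets; $\operatorname{add}(\mathcal N)$ is the least cardinality of a family of null sets whose union is not null. $\mathcal{AN}_{\mathcal A}$: nets of Lebesgue measurable functions $f_A:\mathbb R\to\mathbb R$ that converge pointwise a.e. to a function $f:\mathbb R\to\mathbb R$ which is not Lebesgue measurable. A subset $S$ of a commutative algebra is strongly $\kappa$-algebrable if there is a set $X$ of $\kappa$ algebraically independent elements such that every nonzero element of the (non-unital) algebra generated by $X$ belongs to $S$. *)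

(* Defs.v *)
From mathcomp Require Import all_boot all_order all_algebra.
From mathcomp Require Import all_classical all_reals all_analysis.
From mathcomp Require mpoly.
Set Implicit Arguments. Unset Strict Implicit. Unset Printing Implicit Defensive.
Import GRing.Theory Num.Theory.
Import numFieldNormedType.Exports.
Local Open Scope classical_set_scope.
Local Open Scope ring_scope.

(* ---------- directed sets ---------- *)
Definition directed_set (A : Type) (le : A -> A -> Prop) : Prop :=
  [/\ inhabited A,
      (forall a, le a a),
      (forall a b c, le a b -> le b c -> le a c) &
      (forall a b, exists c, le a c /\ le b c)].

(* strict cardinal inequality |I| < |A| *)
Definition card_lt (I A : Type) : Prop :=
  ([set: I] #<= [set: A])%card /\ ~ ([set: A] #<= [set: I])%card.

(* (A, le) is (order-isomorphic to) a cardinal number, i.e. an initial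
   ordinal with its natural order: le is a well-order and every proper
   initial segment has cardinality strictly smaller than A. *)
Definition is_cardinal_order (A : Type) (le : A -> A -> Prop) : Prop :=
  [/\ (forall a, le a a) /\
      (forall a b, le a b -> le b a -> a = b),
      (forall a b c, le a b -> le b c -> le a c),
      (forall a b, le a b \/ le b a),
      (forall S : set A, S !=set0 -> exists2 m, S m & forall s, S s -> le m s) &
      (forall x : A, card_lt {y : A | le y x /\ y <> x} A)].

(* ---------- Lebesgue null sets and add(N) ---------- *)
Definition null_set {R : realType} (N : set R) : Prop :=
  (@lebesgue_measure R).-negligible N.

(* card A = add(N): some A-indexed family of null sets has non-null union,
   and every family of null sets indexed by a set of cardinality < card A
   has null union. *)
Definition card_is_addN (R : realType) (A : Type) : Prop :=
  (exists F : A -> set R, (forall a, null_set (F a)) /\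
                          ~ null_set (\bigcup_(a in [set: A]) F a)) /\
  (forall (I : Type) (F : I -> set R), card_lt I A ->
     (forall i, null_set (F i)) -> null_set (\bigcup_(i in [set: I]) F i)).

(* ---------- Lebesgue measurable functions ---------- *)
(* R equipped with the Lebesgue (completed, Caratheodory) sigma-algebra *)
Definition LebR (R : realType) :=
  caratheodory_type (R := R) ((wlength (R := R) idfun)^*)%mu.

Definition lebesgue_measurable_fun {R : realType} (f : R -> R) : Prop :=
  measurable_fun [set: LebR R] (f : LebR R -> R).

(* ---------- nets ---------- *)
Definition net_converges (A : Type) (le : A -> A -> Prop) {R : realType}
    (x : A -> R) (l : R) : Prop :=
  forall U, nbhs l U -> exists a0, forall a, le a0 a -> U (x a).

(* AN_A *)
Definition AN (R : realType) (A : Type) (le : A -> A -> Prop)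
    (F : A -> R -> R) : Prop :=
  (forall a, lebesgue_measurable_fun (F a)) /\
  exists f : R -> R, ~ lebesgue_measurable_fun f /\
    exists N : set R, null_set N /\
      forall t, ~ N t -> net_converges le (fun a => F a t) (f t).

(* evaluation of a real polynomial in n variables at n nets, computed
   with the indexwise algebra operations of (R^R)^A *)
Definition net_eval (R : realType) (A : Type) (n : nat)
    (P : mpoly.mpoly n R) (x : 'I_n -> A -> R -> R) : A -> R -> R :=
  fun a t => mpoly.meval (fun j => x j a t) P.

(* S is strongly kappa-algebrable in (R^R)^A, with kappa = card K:
   there is an algebraically independent family (x_k)_{k in K} such that
   every nonzero element of the non-unital algebra it generates lies in S.
   Elements of that algebra are P(x_{k_1},...,x_{k_n}) with P a real
   polynomial without constant term and k_1..k_n distinct. *)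
Definition strongly_algebrable (R : realType) (A : Type) (K : Type)
    (S : (A -> R -> R) -> Prop) : Prop :=
  exists x : K -> (A -> R -> R),
    injective x /\
    forall (n : nat) (k : 'I_n -> K) (P : mpoly.mpoly n R),
      injective k -> (exists m, mpoly.mcoeff m P <> 0) -> mpoly.mcoeff mpoly.mnm0 P = 0 ->
      net_eval P (fun j => x (k j)) <> 0 /\
      S (net_eval P (fun j => x (k j))).
Arguments strongly_algebrable : clear implicits.

(* Main.v *)
Require Import Defs.
From mathcomp Require Import all_boot all_order all_algebra.
From mathcomp Require Import all_classical all_reals all_analysis.
From mathcomp Require mpoly.
From mathcomp Require Import lra.
(* [null_set] must denote the predicate of Defs, not the one of all_analysis. *)
Import Defs.
Set Implicit Arguments. Unset Strict Implicit. Unset Printing Implicit Defensive.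
Import Order.TTheory GRing.Theory Num.Theory.
Import numFieldNormedType.Exports.
Import -(notations) mpoly.
Local Open Scope classical_set_scope.
Local Open Scope ring_scope.

(* Let A be a least initial segment of a well-order of R that indexes null sets
   F_a with non-null union; comparing well-orders by collapse shows that
   card A = add(N). By minimality the sets G_a = \bigcup_{b <= a} F_b form a
   chain of null sets with non-null union U. Order A by inclusion of the G_a,
   after making two of them equal: this is a total preorder that is not
   antisymmetric, hence not a cardinal, and the indicator functions of the G_a
   converge to that of U along it.

   Vitali's argument inside U gives a non-measurable V in U of diameter at most
   1. Copy V into countably many disjoint unit intervals, one for each d in
   nat * seq nat, and let x_k(a) be the constant phi_d(k) on the d-th copy of
   V \cap G_a and 0 elsewhere. Each x_k(a) has null support. A polynomial P
   without constant term takes the value P(phi_d(k_1), ..., phi_d(k_n)) on the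
   d-th copy of V in the limit, so it suffices that this value is nonzero for
   some d. The functions phi_d are chosen so that (phi_d(k_1), ..., phi_d(k_n))
   runs through all of N^n whenever the k_i are distinct, and a nonzero
   polynomial does not vanish on N^n. *)

(** * Translations and null sets for Lebesgue outer measure *)

Section LebesgueOuterMeasure.
Variable R : realType.
Implicit Types (A B U V : set R) (c : R).

Local Notation lambda := ((wlength (R := R) idfun)^*)%mu.

Definition translate c A : set R := [set x | A (x - c)].

Lemma translateK c : cancel (translate c) (translate (- c)).
Proof. by move=> A; apply/funext => x; rewrite /translate /= opprK addrK. Qed.

Lemma ocitv_translate c A : ocitv A ->
  ocitv (translate c A) /\ wlength idfun (translate c A) = wlength idfun A.
Proof.
move=> [[a b] _ <-] /=.
have -> : translate c `]a, b]%classic = `](a + c), (b + c)]%classic.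
  apply/seteqP; split => x; rewrite /translate /= !in_itv /=.
    by rewrite ltrBrDr lerBlDr.
  by rewrite ltrBrDr lerBlDr.
split; first exact: is_ocitv.
rewrite !wlength_itv /= !lte_fin ltrD2r; case: ifP => // _.
by rewrite -!EFinB opprD addrACA subrr addr0.
Qed.

(** Translating a cover by half-open intervals gives a cover of the translate with the same total
    length. *)
Lemma outer_measure_translate_le c A : (lambda (translate c A) <= lambda A)%E.
Proof.
apply: le_ereal_inf_tmp => _ [B [mB AB] <-].
apply: ereal_inf_lbound; exists (fun k => translate c (B k)).
  split=> [k|x /AB[k _ Bk]]; first exact: (ocitv_translate c (mB k)).1.
  by exists k.
by apply: eq_eseriesr => k _; exact: (ocitv_translate c (mB k)).2.
Qed.

Lemma outer_measure_translate c A : lambda (translate c A) = lambda A.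
Proof.
apply/le_anti; rewrite outer_measure_translate_le /=.
by rewrite -{1}(translateK c A) outer_measure_translate_le.
Qed.

Lemma LebR_measurableE A :
  measurable (A : set (LebR R)) = caratheodory_measurable lambda A.
Proof. by []. Qed.

Lemma measurable_translate c A : measurable (A : set (LebR R)) ->
  measurable (translate c A : set (LebR R)).
Proof.
rewrite !LebR_measurableE => mA X.
rewrite -(outer_measure_translate (- c) X) (mA (translate (- c) X)).
rewrite -(outer_measure_translate c (_ `&` A)).
rewrite -(outer_measure_translate c (_ `&` ~` A)).
by congr (lambda _ + lambda _)%E; apply/seteqP; split => x;
  rewrite /translate /= opprK subrK.
Qed.

Lemma outer_measure0_measurable A :
  lambda A = 0%E -> measurable (A : set (LebR R)).
Proof.
move=> A0; apply: le_caratheodory_measurable => X /=.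
have -> : lambda (X `&` A) = 0%E.
  apply/le_anti; rewrite outer_measure_ge0 andbT -A0.
  by apply: le_outer_measure; exact: subIsetr.
by rewrite add0e; apply: le_outer_measure; exact: subIsetl.
Qed.

(** Conversely, outer measure zero gives Caratheodory measurability, so [A] is a Borel set [B]
    together with a negligible [N], and [B] has measure zero by monotonicity. *)
Lemma null_setP A : null_set A <-> lambda A = 0%E.
Proof.
split=> [[B [mB B0 AB]]|A0].
  apply/le_anti; rewrite outer_measure_ge0 andbT.
  by have <- : lambda B = 0%E by []; exact: le_outer_measure.
have := outer_measure0_measurable A0.
have := @completed_caratheodory_measurable R.
rewrite g_sigma_completed_algebra_genE => <- [B mB [N negN BN]].
rewrite /null_set -BN; apply: negligibleU => //.
apply/negligibleP => //; apply/le_anti; rewrite measure_ge0 andbT.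
rewrite -[leRHS]A0 -BN.
by apply: (@le_outer_measure _ _ lambda); exact: subsetUl.
Qed.

Lemma null_set_measurable A : null_set A -> measurable (A : set (LebR R)).
Proof. by move/null_setP; exact: outer_measure0_measurable. Qed.

Lemma null_set_sub A B : A `<=` B -> null_set B -> null_set A.
Proof. by move=> AB; apply: negligibleS. Qed.

Lemma null_set_bigcup (F : nat -> set R) :
  (forall n, null_set (F n)) -> null_set (\bigcup_n F n).
Proof. exact: negligible_bigcup. Qed.

Lemma null_set_countable_cover (I : countType) (F : I -> set R) A :
  A `<=` \bigcup_i F i -> (forall i, null_set (F i)) -> null_set A.
Proof.
move=> AF F0; apply: (@null_set_sub _
  (\bigcup_n (if unpickle n is Some i then F i else set0))).
  by move=> x /AF[i _ Fi]; exists (pickle i) => //; rewrite pickleK.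
apply: null_set_bigcup => n; case: unpickle => [i|]; first exact: F0.
exact: negligible_set0.
Qed.

Lemma null_set_translate c A : null_set A -> null_set (translate c A).
Proof. by rewrite !null_setP outer_measure_translate. Qed.

Lemma null_set1 (x : R) : null_set [set x].
Proof. by apply/negligibleP => //; exact: lebesgue_measure_set1. Qed.

End LebesgueOuterMeasure.

(** * Non-measurable subsets of non-null sets *)

Section Vitali.
Variable R : realType.
Implicit Types (A B U V : set R) (c : R).

Local Notation lambda := ((wlength (R := R) idfun)^*)%mu.

Lemma outer_measure_itvcc (a b : R) : a <= b ->
  lambda `[a, b]%classic = (b - a)%:E.
Proof.
move=> ab; have -> : lambda `[a, b]%classic = lebesgue_measure `[a, b]%classic.
  by [].
rewrite lebesgue_measure_itv /= lte_fin; case: ltgtP ab => // ->.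
by rewrite subrr.
Qed.

(** By additivity, [n] disjoint translates give [n * lambda M <= b - a] for every [n]; the
    Archimedean property leaves only [lambda M = 0]. *)
Lemma measurable_disjoint_translates_null M (r : nat -> R) :
  measurable (M : set (LebR R)) ->
  trivIset setT (fun i => translate (r i) M) ->
  (exists a b : R, a <= b /\
     \bigcup_i translate (r i) M `<=` `[a, b]%classic) ->
  null_set M.
Proof.
move=> mM tM [a [b [ab Mab]]]; apply/null_setP.
have M0 : (0 <= lambda M)%E by exact: outer_measure_ge0.
have bound n : (lambda M *+ n <= (b - a)%:E)%E.
  rewrite -(outer_measure_itvcc ab).
  have := @caratheodory_additive _ _ lambda (fun i => translate (r i) M)
    (fun i => measurable_translate (r i) mM) tM n setT.
  rewrite setTI => H.
  have -> : (lambda M *+ n = \sum_(i < n) lambda (setT `&` translate (r i) M))%E.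
    under eq_bigr do rewrite setTI outer_measure_translate.
    by rewrite big_const_ord iter_addr_0.
  rewrite -H; apply: le_outer_measure; apply: subset_trans Mab.
  exact: bigsetU_bigcup.
have Mfin : lambda M \is a fin_num.
  by rewrite ge0_fin_numE// (le_lt_trans (bound 1%N))// ltry.
move: M0 bound; rewrite -(fineK Mfin); set m := fine _ => m0 bound.
congr (_%:E); apply/eqP; apply: contraT => mN0.
have {mN0 m0} m_gt0 : 0 < m by rewrite lt_def mN0 -lee_fin.
have := bound (Num.truncn ((b - a) / m)).+1.
rewrite -EFin_natmul lee_fin leNgt -[m *+ _]mulr_natl -ltr_pdivrMr//.
by rewrite truncnS_gt.
Qed.

Lemma exists_transversal (P : R -> R -> Prop) :
  (forall x, P x x) -> (forall x y, P x y -> P y x) ->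
  (forall x y z, P x y -> P y z -> P x z) ->
  exists rep : R -> R, (forall x, P x (rep x)) /\
    (forall x y, P x y -> rep x = rep y).
Proof.
move=> Prefl Psym Ptrans; exists (fun x => xget 0 (P x)); split=> [x|x y Pxy].
  by apply: (@xgetPex _ 0 (P x)); exists x.
congr (xget 0 _); apply/funext => z; apply/propext; split => ?.
  exact: Ptrans (Psym _ _ Pxy) _.
exact: Ptrans Pxy _.
Qed.

(* A transversal of R/Q cuts [U] into countably many pieces, each of which has
   infinitely many disjoint translates in a bounded interval and hence is null
   as soon as it is measurable. *)
Lemma exists_nonmeasurable_subset U : ~ null_set U ->
  exists (m : int) (V : set R), [/\ V `<=` U,
    (forall t, V t -> m%:~R <= t < m%:~R + 1) &
    ~ measurable (V : set (LebR R))].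
Proof.
move=> Unull; apply: contrapT => NV; apply: Unull.
have [|||rep [repP repE]] := @exists_transversal (fun x y => exists q : rat, x - y = ratr q).
- by move=> x; exists 0; rewrite subrr rmorph0.
- by move=> x y [q xy]; exists (- q); rewrite -opprB xy rmorphN.
- move=> x y z [q xy] [s yz]; exists (q + s).
  by rewrite rmorphD /= -xy -yz addrA subrK.
pose B (i : int * rat) : set R :=
  [set t | [/\ U t, i.1%:~R <= t < i.1%:~R + 1 & t - rep t = ratr i.2]].
apply: (@null_set_countable_cover _ _ B) => [t Ut|[m q]].
  have [q tq] := repP t; exists (Num.floor t, q) => //; split => //=.
  by rewrite -intrD1 floor_itv.
have mB : measurable (B (m, q) : set (LebR R)).
  apply: contrapT => nB; apply: NV; exists m, (B (m, q)).
  by split=> // t [].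
apply: (@measurable_disjoint_translates_null _ (fun i => i.+1%:R^-1)) => //.
  (* The two preimages of [t] differ by a rational, so they share a representative; both lie at
     distance [ratr q] from it, which forces [i = j]. *)
  apply/trivIsetP => i j _ _ ij; rewrite -subset0 => t [].
  rewrite /translate /B /= => -[_ _ ti] [_ _ tj].
  have rr : rep (t - i.+1%:R^-1) = rep (t - j.+1%:R^-1).
    apply: repE; exists (j.+1%:R^-1 - i.+1%:R^-1).
    by rewrite opprD opprK addrACA subrr add0r addrC rmorphB /= !fmorphV /= !ratr_nat.
  move: ti; rewrite rr -tj => /addIr /addrI /oppr_inj /invr_inj /eqP.
  by rewrite eqr_nat eqSS (negbTE ij).
exists m%:~R, (m%:~R + 2); split; first by rewrite lerDl.
move=> t [i _]; rewrite /translate /B /= in_itv /= => -[_ /andP[mt tm] _].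
have i0 : 0 <= i.+1%:R^-1 :> R by rewrite invr_ge0.
have i1 : i.+1%:R^-1 <= 1 :> R by rewrite invf_le1 // ler1n.
apply/andP; split; first by rewrite (le_trans mt)// gerBl.
by move: tm; rewrite ltrBlDr => /ltW/le_trans; apply; rewrite -addrA lerD2l lerD2l.
Qed.

End Vitali.

(** * Step functions and polynomials on natural points *)

Lemma base_digits_inj (D n : nat) (f g : 'I_n -> nat) :
  (forall i, f i < D)%N -> (forall i, g i < D)%N ->
  (\sum_i f i * D ^ i = \sum_i g i * D ^ i)%N -> f =1 g.
Proof.
elim: n f g => [|n IHn] f g fD gD; first by move=> _ [].
have step h : (\sum_(i < n.+1) h i * D ^ i =
    (\sum_(i < n) h (lift ord0 i) * D ^ i) * D + h ord0)%N.
  rewrite big_ord_recl expn0 muln1 addnC big_distrl /=; congr addn.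
  by apply: eq_bigr => i _; rewrite /bump /= add1n expnSr mulnA.
rewrite !step => fg i.
have D0 : (0 < D)%N by apply: leq_ltn_trans (fD i).
have fg0 : f ord0 = g ord0.
  by have := congr1 (modn^~ D) fg; rewrite !modnMDl !modn_small.
have fgS : (fun i => f (lift ord0 i)) =1 (fun i => g (lift ord0 i)).
  apply: IHn => // ; have := congr1 (divn^~ D) fg.
  by rewrite !divnMDl // !divn_small // !addn0.
by case: (unliftP ord0 i) => [j ->|->]; [exact: fgS|].
Qed.

Lemma poly_nat_nonroot (R : realDomainType) (p : {poly R}) : p != 0 ->
  exists b : nat, p.[b%:R] != 0.
Proof.
move=> p0; apply: contrapT => roots.
have : (size [seq i%:R : R | i <- iota 0 (size p)] < size p)%N.
  apply: max_poly_roots => //.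
    apply/allP => _ /mapP[b _ ->]; apply: contrapT => /negP nr.
    by apply: roots; exists b.
  by rewrite map_inj_uniq ?iota_uniq // => i j /eqP; rewrite eqr_nat => /eqP.
by rewrite size_map size_iota ltnn.
Qed.

(* Kronecker substitution X_i := X^(D^i). *)
Lemma mpoly_nat_nonroot (R : realDomainType) (n : nat) (P : mpoly.mpoly n R) m :
  mpoly.mcoeff m P <> 0 ->
  exists v : 'I_n -> nat, mpoly.meval (fun i => (v i)%:R) P <> 0.
Proof.
move=> Pm; pose D := mpoly.msize P.
pose e (k : mpoly.multinom n) := (\sum_i k i * D ^ i)%N.
have small k : k \in mpoly.msupp P -> forall i, (k i < D)%N.
  move=> /(@mpoly.msize_mdeg_lt _ _ _ _) kD i; apply: leq_ltn_trans kD.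
  by rewrite mpoly.mdegE (bigD1 i) //= leq_addr.
pose Q : {poly R} := \sum_(k <- mpoly.msupp P) mpoly.mcoeff k P *: 'X^(e k).
have mP : m \in mpoly.msupp P by rewrite mpoly.mcoeff_msupp; apply/eqP.
(* Exponents of monomials in the support are digits below [D], so [e] is injective there and the
   coefficient of [Q] at [e m] is that of [P] at [m]. *)
have Q0 : Q != 0.
  apply: contra_not_neq Pm => /(congr1 (fun q : {poly R} => q`_(e m))).
  rewrite coef0 coef_sum (bigD1_seq m) ?mpoly.msupp_uniq //=.
  rewrite coefZ coefXn eqxx mulr1 big_seq_cond big1 ?addr0 // => k.
  move=> /andP[kP km]; rewrite coefZ coefXn; case: eqP => [mk|]; last by rewrite mulr0.
  case/eqP: km; apply/mpoly.mnmP => i.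
  by apply: (@base_digits_inj D) => //; apply: small.
have [b Qb] := poly_nat_nonroot Q0.
exists (fun i => b ^ (D ^ i))%N; apply/eqP; apply: contra_neq Qb => <-.
rewrite mpoly.mevalE horner_sum; apply: eq_bigr => k _.
rewrite hornerZ hornerXn; congr (_ * _); rewrite /e -natrX expn_sum natr_prod.
by apply: eq_bigr => i _; rewrite -natrX -expnM mulnC.
Qed.

Section SampledFamily.
Variable R : realType.

(* [d = (N, s)] codes a function that is constant on each interval
   [i/N, (i + 1)/N[. *)
Definition sample (d : nat * seq nat) (k : R) : nat :=
  nth 0%N d.2 (pickle (Num.floor (d.1%:R * k))).

(** Once [N] exceeds the inverse of every gap, scaled points are more than 1 apart and cannot share
    a floor. *)
Lemma floor_separates (n : nat) (k : 'I_n -> R) : injective k ->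
  exists N : nat, injective (fun i => Num.floor (N%:R * k i)).
Proof.
move=> k_inj; pose N0 i j := (Num.truncn (`|k i - k j|^-1)).+1.
pose N := (\max_i \max_j N0 i j)%N.
exists N => i j /= ij; apply: k_inj; apply/eqP; apply: contraT => kij.
have kij0 : 0 < `|k i - k j| by rewrite normr_gt0 subr_eq0.
have NN0 : (N0 i j <= N)%N.
  by rewrite /N (leq_trans _ (leq_bigmax i)) // (leq_bigmax j).
have : 1 < N%:R * `|k i - k j|.
  rewrite -ltr_pdivrMr // div1r (lt_le_trans (truncnS_gt _)) //.
  by rewrite ler_nat.
rewrite ltNge => /negP; case.
rewrite -(ger0_norm (ler0n R N)) -normrM mulrBr ler_norml.
have := floor_itv (N%:R * k i); have := floor_itv (N%:R * k j).
rewrite ij !intrD1; set f : R := _%:~R; move: f (N%:R * k i) (N%:R * k j) => f x y.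
by move=> /andP[? ?] /andP[? ?]; apply/andP; split; lra.
Qed.

Lemma sample_onto (n : nat) (k : 'I_n -> R) (v : 'I_n -> nat) :
  injective k -> exists d, forall i, sample d (k i) = v i.
Proof.
move=> /floor_separates[N N_inj].
pose c i := pickle (Num.floor (N%:R * k i)).
have c_inj : injective c by move=> i j /(pcan_inj pickleK) /N_inj.
(* A finite table holding [v j] at position [c j] and 0 elsewhere, long enough to contain every
   [c i]. *)
exists (N, mkseq (fun p => if [pick j | c j == p] is Some j then v j else 0%N)
           (\max_i (c i).+1)%N) => i.
rewrite /sample /= nth_mkseq; last by rewrite (leq_bigmax i).
by case: pickP => [j /eqP /c_inj ->|/(_ i)]; rewrite ?eqxx.
Qed.

End SampledFamily.

(** * Well-orders and add(N) *)

Lemma card_le_setTP (I A : Type) :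
  ([set: I] #<= [set: A])%card <-> exists j : I -> A, injective j.
Proof.
split=> [/card_leP[f]|[j j_inj]].
  pose e (i : I) : [set: I] := SigSub (mem_set (Logic.I : [set: I] i)).
  exists (fun i => val (f (e i))) => x y xy.
  have /(congr1 val) // : e x = e y.
  by apply: ('inj_f); rewrite ?inE //; exact: val_inj.
have -> : [set: I] = j @^-1` [set: A] by [].
by apply: card_ge_preimage => x y _ _; exact: j_inj.
Qed.

Section WellOrder.
Variables (T : choiceType) (le : rel T).
Hypothesis le_wo : wochoice.well_order le.
Implicit Types (S : set T) (x y z : T).

Let lt x y := le x y /\ x <> y.
Let least S m := S m /\ forall s, S s -> le m s.

Lemma wo_least S : S !=set0 -> exists m, least S m.
Proof.
move=> [x Sx]; have [|m [[Sm minm] _]] := @le_wo [pred y | `[< S y >]].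
  by exists x; apply/asboolP.
exists m; split; first exact/asboolP.
by move=> s Ss; apply: minm; apply/asboolP.
Qed.

Lemma wo_total x y : le x y \/ le y x.
Proof.
have [|m [[->|->] minm]] := @wo_least [set x; y]; first by exists x; left.
- by left; apply: minm; right.
- by right; apply: minm; left.
Qed.

Lemma wo_refl x : le x x.
Proof. by case: (wo_total x x). Qed.

(** Both points are minima of the pair, and [well_order] makes the minimum unique. *)
Lemma wo_anti x y : le x y -> le y x -> x = y.
Proof.
move=> xy yx; have [|m [_ uniq_m]] := @le_wo (pred2 x y).
  by exists x; rewrite !inE eqxx.
have <- : m = x.
  apply: uniq_m; split; first by rewrite !inE eqxx.
  by move=> z; rewrite !inE => /orP[] /eqP ->; rewrite ?wo_refl.
apply: uniq_m; split; first by rewrite !inE eqxx orbT.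
by move=> z; rewrite !inE => /orP[] /eqP ->; rewrite ?wo_refl.
Qed.

Lemma wo_trans x y z : le x y -> le y z -> le x z.
Proof.
move=> xy yz.
have [|m [[[->|->]|->] minm]] := @wo_least ([set x; y] `|` [set z]).
- by exists x; left; left.
- by apply: minm; right.
- by rewrite (wo_anti xy (minm x _)) //; left; left.
- by rewrite -(wo_anti yz (minm y _)) //; left; right.
Qed.

Lemma wo_ltNge x y : ~ le x y -> lt y x.
Proof.
move=> nxy; have [//|yx] := wo_total x y.
by split => // xE; apply: nxy; rewrite xE wo_refl.
Qed.

Lemma wo_lt_wf : well_founded lt.
Proof.
move=> x; apply: contrapT => nAcc.
have [|m [mN minm]] := @wo_least [set y | ~ Acc lt y]; first by exists x.
apply: mN; constructor => y [ym yNm]; apply: contrapT => /minm my.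
exact/yNm/wo_anti.
Qed.

(* [f] is the Mostowski collapse of [S']. *)
Lemma wo_collapse S S' : S' `<=` S ->
  (forall x y, S x -> le y x -> S y) ->
  exists f : T -> T, {in S' &, injective f} /\
    (f @` S' = S \/
     exists2 y, S y & f @` S' = [set z | lt z y]).
Proof.
move=> S'S Sdown; have [[x0 _]|S0] := pselect (S !=set0); last first.
  exists id; split; first by move=> x y.
  by left; rewrite image_id; apply/seteqP; split => // x Sx; case: S0; exists x.
(* Recursively, [f x] is the least point not yet taken by an element of [S'] below [x]. *)
pose step x (g : forall y, lt y x -> T) :=
  xget x0 (least [set z | ~ exists y (yx : lt y x), S' y /\ z = g y yx]).
pose f := Fix wo_lt_wf (fun=> T) step.
have fE x : f x = xget x0 (least (~` (f @` [set y | S' y /\ lt y x]))).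
  rewrite /f Fix_eq; last first.
    move=> y g h gh; congr (step _ _).
    by apply: functional_extensionality_dep => z;
       apply: functional_extensionality_dep => yz.
  rewrite /step; congr (xget _ (least _)); apply/seteqP; split => z /= nz.
    by move=> [y [S'y yx] fyz]; apply: nz; exists y, yx; split => //; exact/esym.
  by move=> [y [yx [S'y zE]]]; apply: nz; exists y => //; exact/esym.
(* Inductively [f y <= y < x] for earlier [y], so [x] itself is still free: the default [x0] never
   occurs, and [f x <= x] keeps the values in [S]. *)
have fP x : least (~` (f @` [set y | S' y /\ lt y x])) (f x) /\ le (f x) x.
  elim/(well_founded_ind wo_lt_wf): x => x IHx.
  have xN : (~` (f @` [set y | S' y /\ lt y x])) x.
    move=> [y [S'y yx] fyx]; have [_] := IHx _ yx; rewrite fyx.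
    by case: yx => yx yNx /(wo_anti yx).
  have lfx : least (~` (f @` [set y | S' y /\ lt y x])) (f x).
    by rewrite [X in least _ X]fE; apply: xgetPex; apply: wo_least; exists x.
  by split => //; apply: lfx.2.
have f_init x z : lt z (f x) -> exists2 y, S' y & f y = z.
  move=> [zfx zNfx]; apply: contrapT => nz; apply/zNfx/wo_anti => //.
  by apply: (fP x).1.2 => -[y [S'y _] fy]; apply: nz; exists y.
have f_neq x y : S' x -> lt x y -> f x <> f y.
  by move=> S'x xy fxy; have [[+ _] _] := fP y; apply; exists x.
exists f; split.
  move=> x y /set_mem S'x /set_mem S'y fxy; apply: contrapT => xNy.
  have [xy|yx] := wo_total x y; first by apply: (@f_neq x y).
  by apply: (@f_neq y x) => //; split => // /esym.
have fS x : S' x -> S (f x).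
  by move=> S'x; apply: Sdown (S'S _ S'x) _; exact: (fP x).2.
have [fSS|] := pselect (S `<=` f @` S').
  by left; apply/seteqP; split => // _ [x S'x <-]; exact: fS.
move=> /existsNP[x /not_implyP[Sx xN]]; right.
have [|y [[Sy yN] miny]] := @wo_least (S `\` f @` S'); first by exists x.
exists y => //; apply/seteqP; split => z /=.
  move=> [w S'w <-]; apply: wo_ltNge => yfw; apply: yN.
  have [yE|yNfw] := pselect (y = f w); first by exists w.
  by have [v S'v <-] := @f_init w y (conj yfw yNfw); exists v.
move=> [zy zNy]; apply: contrapT => zN; apply/zNy/wo_anti => //.
by apply: miny; split => //; apply: Sdown Sy _.
Qed.

End WellOrder.

Section AdditivityOfNullSets.
Variable R : realType.

Definition carries_nonnull (S : set R) := exists F : R -> set R,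
  (forall x, S x -> null_set (F x)) /\ ~ null_set (\bigcup_(x in S) F x).

Lemma carries_nonnull_setT : carries_nonnull setT.
Proof.
exists (fun x => [set x]); split => [x _|]; first exact: null_set1.
have -> : \bigcup_(x in setT) [set x] = [set: R].
  by apply/seteqP; split => // x _; exists x.
move=> /(null_set_sub (@subsetT _ `[0, 1]%classic)) /null_setP.
by rewrite outer_measure_itvcc // subr0 => -[] /eqP; rewrite oner_eq0.
Qed.

Lemma nonnull_of_injection (I : Type) (F : I -> set R) (h : I -> R) :
  injective h -> (forall i, null_set (F i)) ->
  ~ null_set (\bigcup_(i in [set: I]) F i) -> carries_nonnull (range h).
Proof.
move=> h_inj F0 FN; exists (fun x => \bigcup_(i in h @^-1` [set x]) F i).
split=> [_ [i _ <-]|].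
  by apply: null_set_sub (F0 i) => t [j /h_inj ->].
apply: contra_not FN; apply: null_set_sub => t [i _ Fit].
by exists (h i); [exists i|exists i].
Qed.

(** [S] is the segment below the least point whose segment carries a non-null union, or all of [R]
    if there is no such point. *)
Lemma exists_minimal_carrier : exists (le : rel R) (S : set R),
  [/\ wochoice.well_order le, (forall x y, S x -> le y x -> S y),
      carries_nonnull S &
      forall x, S x -> ~ carries_nonnull [set y | le y x /\ y <> x]].
Proof.
have [le le_wo] := wochoice.well_ordering_principle R; exists le.
pose seg x : set R := [set y | le y x /\ y <> x].
have [[x cx]|none] := pselect (exists x, carries_nonnull (seg x)); last first.
  exists setT; split => //; first exact: carries_nonnull_setT.
  by move=> x _ cx; apply: none; exists x.
have [|m [cm minm]] := wo_least le_wo (S := [set x | carries_nonnull (seg x)]).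
  by exists x.
exists (seg m); split => //.
  move=> y z [ym yNm] zy; split; first exact: wo_trans zy ym.
  by move=> zm; apply: yNm; apply: (wo_anti le_wo) => //; rewrite -zm.
by move=> y [ym yNm] /minm my; apply: yNm; apply: (wo_anti le_wo).
Qed.

(* The repeated set [G a = G b] makes the inclusion preorder on [A] fail to be
   antisymmetric. *)
Lemma exists_addN_chain : exists (A : Type) (G : A -> set R),
  [/\ card_is_addN R A,
      (forall a, null_set (G a)),
      (forall a b, G a `<=` G b \/ G b `<=` G a),
      ~ null_set (\bigcup_(a in [set: A]) G a) &
      exists a b, a <> b /\ G a = G b].
Proof.
have [le [S [le_wo Sdown [F [F0 FN]] Smin]]] := exists_minimal_carrier.
pose A := {x : R | S x}.
pose H (a : A) : set R := \bigcup_(x in [set x | le x (sval a)]) F x.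
have HS : \bigcup_(a in [set: A]) H a = \bigcup_(x in S) F x.
  apply/seteqP; split => t.
    move=> [[a Sa] _ [x xa Fxt]]; exists x => //; exact: Sdown Sa xa.
  by move=> [x Sx Fxt]; exists (exist _ x Sx) => //; exists x => //=; exact: wo_refl.
have H0 a : null_set (H a).
  case: a => a Sa; pose seg := [set y | le y a /\ y <> a].
  have seg0 : null_set (\bigcup_(x in seg) F x).
    apply: contrapT => segN; apply: (Smin a Sa); exists F; split => // x [xa _].
    by apply: F0; exact: Sdown Sa xa.
  apply: (@null_set_sub _ _ ((\bigcup_(x in seg) F x) `|` F a)).
    move=> t [x /= xa Fxt]; have [<-|xNa] := pselect (x = a); first by right.
    by left; exists x.
  exact: negligibleU (seg0) (F0 _ Sa).
have Hchain a b : H a `<=` H b \/ H b `<=` H a.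
  have [ab|ba] := wo_total le_wo (sval a) (sval b); [left|right];
  by move=> t [x /= xa Fxt]; exists x => //=; apply: (wo_trans le_wo) xa _.
(* Otherwise the chain property leaves at most one index, and the whole union would be null. *)
have [a [b [ab Hba]]] : exists a b, a <> b /\ H b `<=` H a.
  apply: contrapT => sub; apply: FN; rewrite -HS.
  have [[a _]|A0] := pselect (exists a : A, True); last first.
    apply: (@null_set_sub _ _ set0); last exact: negligible_set0.
    by move=> t [a _ _]; apply: A0; exists a.
  apply: null_set_sub (H0 a) => t [b _ Hbt].
  have [->//|ab] := pselect (a = b).
  have [Hab|Hba] := Hchain a b; last exact: Hba.
  by case: sub; exists b, a; split => // /esym.
(* Enlarging [H b] to [H a] creates the repetition, keeps a chain of null sets, and loses no point
   of the union. *)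
pose G c := if pselect (c = b) then H a else H c.
have GH c : exists d, G c = H d.
  by rewrite /G; case: pselect => ?; [exists a|exists c].
exists A, G; split.
- split; first by exists H; split => //; rewrite HS.
  move=> I E [/card_le_setTP[j j_inj] nAI] E0; apply: contrapT => EN.
  pose k i := sval (j i).
  have k_inj : injective k.
    by move=> x y /eq_sig_hprop-/(_ (fun _ _ _ => Prop_irrelevance _ _)) /j_inj.
  have kS : range k `<=` S by move=> _ [i _ <-]; exact: (svalP (j i)).
  (* The collapse puts [I] in bijection with [S], which would inject [A] into [I], or with a proper
     segment, against the minimality of [S]. *)
  have [f [f_inj fk]] := wo_collapse le_wo kS Sdown.
  have fk_inj : injective (f \o k).
    move=> x y /f_inj; rewrite !inE => /(_ _ _)/k_inj; apply; by [exists x|exists y].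
  have rfk : range (f \o k) = f @` range k by rewrite image_comp.
  case: fk => [fS|[y Sy fy]].
    apply: nAI; apply/card_le_setTP.
    have : forall c : A, exists i, f (k i) = sval c.
      move=> c; have := svalP c; rewrite -{1}fS => -[_ [i _ <-] fc].
      by exists i.
    move=> /choice[g gP]; exists g => c d gcd.
    by apply: eq_sig_hprop => [? ? ?|]; [exact: Prop_irrelevance|rewrite -!gP gcd].
  by apply: (Smin y Sy); rewrite -fy -rfk; exact: nonnull_of_injection EN.
- by move=> c; have [d ->] := GH c.
- by move=> c d; have [c' ->] := GH c; have [d' ->] := GH d.
- apply: contra_not FN; rewrite -HS; apply: null_set_sub => t [c _ Hct].
  have [cb|cNb] := pselect (c = b).
    exists a => //; rewrite /G; case: pselect => // ?; apply: Hba.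
    by rewrite -cb.
  by exists c => //; rewrite /G; case: pselect.
- by exists a, b; split => //; rewrite /G; case: pselect => //; case: pselect.
Qed.

End AdditivityOfNullSets.

(** * The algebraically independent family of nets *)

Lemma meval_at0 (R : comNzRingType) n (P : mpoly.mpoly n R) (v : 'I_n -> R) :
  mpoly.mcoeff mpoly.mnm0 P = 0 -> (forall i, v i = 0) -> mpoly.meval v P = 0.
Proof.
move=> P0 v0; rewrite mpoly.mevalE big1 // => m _.
have [->|/eqP m0] := eqVneq m mpoly.mnm0; first by rewrite P0 mul0r.
have [i mi] : exists i, m i != 0%N.
  apply: contrapT => all0; apply: m0; apply/mpoly.mnmP => i.
  rewrite mpoly.mnm0E; apply/eqP; apply: contrapT => /negP mi.
  by apply: all0; exists i.
by rewrite (bigD1 i) //= v0 expr0n (negbTE mi) mul0r mulr0.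
Qed.

Section NullSupport.
Variable R : realType.

(** Each preimage is null or has null complement, according to whether the target set contains 0. *)
Lemma null_support_measurable (N : set R) (f : R -> R) :
  null_set N -> (forall t, ~ N t -> f t = 0) -> lebesgue_measurable_fun f.
Proof.
move=> N0 f0 _ Y mY; rewrite setTI.
have [Y0|NY0] := pselect (Y 0); last first.
  apply: null_set_measurable; apply: null_set_sub N0 => t Yft.
  by apply: contrapT => /f0 ft; apply: NY0; rewrite -ft.
rewrite -[X in measurable X]setCK; apply: measurableC.
apply: null_set_measurable; apply: null_set_sub N0 => t nYft.
by apply: contrapT => /f0 ft; apply: nYft; rewrite /= ft.
Qed.

Lemma LebR_measurable_itv (i : interval R) :
  measurable ([set` i] : set (LebR R)).
Proof. by apply: sub_caratheodory; exact: measurable_itv. Qed.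

End NullSupport.

Section Witness.
Variables (R : realType) (A : Type) (G : A -> set R) (m : int) (V : set R).
Hypothesis G0 : forall a, null_set (G a).
Hypothesis VG : V `<=` \bigcup_(a in [set: A]) G a.
Hypothesis Vm : forall t, V t -> m%:~R <= t < m%:~R + 1.
Hypothesis Vnm : ~ measurable (V : set (LebR R)).

Let le a b := G a `<=` G b.

(* [t] lies in the interval [m + n, m + n + 1[ with [n = floor t - m]; its base
   point is [t - n], and [n] is decoded into an index of [sample]. *)
Let base (t : R) : R := t - (Num.floor t - m)%:~R.

Let code (t : R) : nat * seq nat :=
  odflt (0%N, [::]) (unpickle `|Num.floor t - m|%N).

Let W a : set R := [set t | V (base t) /\ G a (base t)].

Let W0 a : null_set (W a).
Proof.
apply: (@null_set_countable_cover _ _ (fun z : int => translate z%:~R (G a))).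
  by move=> t [_ Gt]; exists (Num.floor t - m).
by move=> z; exact: null_set_translate.
Qed.

Definition witness (k : R) (a : A) (t : R) : R :=
  if `[< W a t >] then (sample (code t) k)%:R else 0.

Let floor_piece (d : nat * seq nat) (t : R) : (m + (pickle d)%:Z)%:~R <= t < (m + (pickle d)%:Z)%:~R + 1 ->
  code t = d /\ base t = t - (pickle d)%:R.
Proof.
rewrite -intrD1 => /floor_def ft.
by rewrite /code /base ft addrAC subrr add0r absz_nat pickleK.
Qed.

Let piece_translate (d : nat * seq nat) (t : R) : V (t - (pickle d)%:R) ->
  (m + (pickle d)%:Z)%:~R <= t < (m + (pickle d)%:Z)%:~R + 1.
Proof.
move=> /Vm; rewrite intrD -pmulrn lerBrDr ltrBlDr => /andP[-> /=].
by rewrite addrAC.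
Qed.

Let piece_point (d : nat * seq nat) : exists a t, W a t /\ code t = d.
Proof.
have [[v Vv]|V0] := pselect (V !=set0); last first.
  case: Vnm; suff -> : V = set0 by exact: measurable0.
  by apply/seteqP; split => // t Vt; apply: V0; exists t.
have [a _ Gav] := VG Vv; exists a, (v + (pickle d)%:R).
have Vt : V (v + (pickle d)%:R - (pickle d)%:R) by rewrite addrK.
have [ct bt] := floor_piece (piece_translate Vt).
by split=> //; rewrite /W /= bt addrK.
Qed.

Lemma witness_inj : injective witness.
Proof.
move=> k k' kk'; apply/eqP; apply: contraT => kNk'.
have k2_inj : injective (fun i : 'I_2 => if i == ord0 then k else k').
  move=> [[|[|//]] ip] [[|[|//]] jp] //= kE; try exact: val_inj.
    by rewrite kE eqxx in kNk'.
  by rewrite kE eqxx in kNk'.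
(* This index [d] gives the value 1 at [k] and 0 at [k']. *)
have [d dk] := sample_onto (fun i : 'I_2 => (i == ord0 : nat)) k2_inj.
have [a [t [Wt ct]]] := piece_point d.
have := congr1 (fun x => x a t) kk'; rewrite /witness asboolT // ct.
by have /= -> := dk ord0; have /= -> := dk (lift ord0 ord0) => /eqP; rewrite oner_eq0.
Qed.

Section Evaluation.
Variables (n : nat) (k : 'I_n -> R) (P : mpoly.mpoly n R).
Hypothesis k_inj : injective k.
Hypothesis P_neq0 : exists mm, mpoly.mcoeff mm P <> 0.
Hypothesis P_0 : mpoly.mcoeff mpoly.mnm0 P = 0.

Let val t := mpoly.meval (fun j => (sample (code t) (k j))%:R : R) P.

Lemma witness_net_evalE a t :
  net_eval P (fun j => witness (k j)) a t = if `[< W a t >] then val t else 0.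
Proof.
rewrite /net_eval /witness; case: asboolP => // Wt.
exact: meval_at0.
Qed.

Lemma witness_value : exists (d : nat * seq nat) (c : R), c != 0 /\ forall t, code t = d -> val t = c.
Proof.
have [mm Pmm] := P_neq0; have [v Pv] := mpoly_nat_nonroot Pmm.
have [d dk] := sample_onto v k_inj.
exists d, (mpoly.meval (fun i => (v i)%:R) P); split; first exact/eqP.
by move=> t ct; apply: mpoly.meval_eq => i; rewrite ct dk.
Qed.

Lemma witness_net_eval_neq0 : net_eval P (fun j => witness (k j)) <> 0.
Proof.
have [d [c [c0 dc]]] := witness_value; have [a [t [Wt ct]]] := piece_point d.
move=> /(congr1 (fun x => x a t)); rewrite witness_net_evalE asboolT // dc //.
exact/eqP.
Qed.

Let limit t := if `[< V (base t) >] then val t else 0.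

(** On the [d]-th interval the limit is [c <> 0] on the copy of [V] and 0 off it, so a level set
    there is a translate of [V]. *)
Lemma witness_limit_nonmeasurable : ~ lebesgue_measurable_fun limit.
Proof.
have [d [c [c0 dc]]] := witness_value => limit_meas; apply: Vnm.
rewrite -(translateK (pickle d)%:R V); apply: measurable_translate.
pose I : set R := `[(m + (pickle d)%:Z)%:~R, (m + (pickle d)%:Z)%:~R + 1[%classic.
have -> : translate (pickle d)%:R V = I `&` ([set: LebR R] `&` limit @^-1` [set c]).
  apply/seteqP; split => t; rewrite /translate /limit /I /=.
    move=> Vt; have It := piece_translate Vt; have [ct bt] := floor_piece It.
    by rewrite in_itv /=; split => //; split => //; rewrite asboolT ?bt // dc.
  rewrite in_itv /= => -[It [_]]; have [ct <-] := floor_piece It.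
  by case: asboolP => // _ /eqP; rewrite eq_sym (negbTE c0).
apply: measurableI; first exact: LebR_measurable_itv.
by apply: limit_meas => //; exact: measurable_set1.
Qed.

Lemma witness_AN : AN le (net_eval P (fun j => witness (k j))).
Proof.
split=> [a|].
  apply: (null_support_measurable (W0 a)) => t Wt.
  by rewrite witness_net_evalE asboolF.
exists limit; split; first exact: witness_limit_nonmeasurable.
exists set0; split; first exact: negligible_set0.
(* Convergence holds at every [t]: the net equals its limit from the first [a] with [base t] in
   [G a], or is constantly 0 when [base t] is outside [V]. *)
move=> t _ X /nbhs_singleton; rewrite /limit; case: asboolP => Vt Xt.
  have [a _ Ga] := VG Vt; exists a => b ab.
  by rewrite witness_net_evalE asboolT //; split => //; exact: ab.
have [a [_ _]] := piece_point (0%N, [::]); exists a => b _.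
by rewrite witness_net_evalE asboolF // => -[].
Qed.

End Evaluation.

Lemma witness_strongly_algebrable : strongly_algebrable R A R (AN le).
Proof.
exists witness; split; first exact: witness_inj.
by move=> n k P k_inj P0 P00; split; [exact: witness_net_eval_neq0|exact: witness_AN].
Qed.

End Witness.

Theorem mainTheorem5 (R : realType) :
  exists (A : Type) (le : A -> A -> Prop),
    [/\ directed_set le,
        ~ is_cardinal_order le,
        card_is_addN R A &
        strongly_algebrable R A R (AN le)].
Proof.
have [A [G [Aadd G0 Gchain GN [a [b [ab Gab]]]]]] := exists_addN_chain R.
have [m [V [VG Vm Vnm]]] := exists_nonmeasurable_subset GN.
exists A, (fun c d => G c `<=` G d); split => //.
- split => //.
  + by move=> c.
  + by move=> c d e; exact: subset_trans.
  + by move=> c d; have [cd|dc] := Gchain c d; [exists d|exists c]; split => //; exact: subset_refl.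
- by move=> [[_ anti] _ _ _ _]; apply: ab; apply: anti; rewrite Gab.
- exact: witness_strongly_algebrable VG Vm Vnm.
Qed.
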